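(* There is a register machine (addition machine) with four integer registers which, on input of two integers $x$ and $y$, outputs $x\cdot y$ and whose number of executed steps is $O(n)$, where $n$ is the number of binary digits of the smaller of $|x|,|y|$. In particular, squaring a number $x$ can be done by a register machine with four registers in time proportional to $\log(|x|)$ for $|x|\geq 2$.
   Context: Model (addition machine): a program is a finite list of numbered lines; the machine has finitely many registers, each holding an arbitrary integer. Allowed commands, each counting as one step, are: $x=y+z$, $x=y+k$, $x=y-z$, $x=y-k$, $x=k-y$, $x=k$ (for registers $x,y,z$, not necessarily distinct, and integer constants $k$); ''read $x$'' (reads one whole integer input into a register) and ''write $x$'' (outputs the whole content of a register); ''if $x\,R\,y$ then ... else ...'' and ''if $x\,R\,k$ then ... else ...'' with $R\in\{<,=,>,\neq,\leq,\geq\}$; and ''goto $\ell$'' for a fixed line number $\ell$. In addition the program may use finitely many variables with a fixed finite range of values; these do not count as registers (they can be eliminated by making finitely many copies of the program). The number of registers of a machine is the number of integer registers it uses. The size of an integer $x$ is its number of binary digits, i.e. the least $n\geq 1$ with $-2^n<x<2^n$; running time is the number of executed commands. *)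

(* Defs.v *)
From HB Require Import structures.
From mathcomp Require Import all_boot all_order all_algebra.
Set Implicit Arguments.
Unset Strict Implicit.
Unset Printing Implicit Defensive.
Import Order.TTheory GRing.Theory Num.Theory.
Local Open Scope ring_scope.

Inductive comparator := CLt | CEq | CGt | CNe | CLe | CGe.

Definition compare_int (R : comparator) (a b : int) : bool :=
  match R with
  | CLt => a < b
  | CEq => a == b
  | CGt => a > b
  | CNe => a != b
  | CLe => a <= b
  | CGe => a >= b
  end.

(* A valuation of m auxiliary variables, each with the finite range
   {0, ..., r}; the range is nonempty whatever r is. *)
Definition valuation (m r : nat) := {ffun 'I_m -> 'I_r.+1}.

(* k integer registers. The branches of a conditional are line numbers. The
   last two commands handle the finite-range variables: they can assign to one
   variable, or branch on, anything that depends on these variables only. *)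
Inductive command (k m r : nat) :=
| AddReg (x y z : 'I_k)
| AddConst (x y : 'I_k) (a : int)
| SubReg (x y z : 'I_k)
| SubConst (x y : 'I_k) (a : int)
| ConstSub (x : 'I_k) (a : int) (y : 'I_k)
| Const (x : 'I_k) (a : int)
| Read (x : 'I_k)
| Write (x : 'I_k)
| IfReg (R : comparator) (x y : 'I_k) (l1 l2 : nat)
| IfConst (R : comparator) (x : 'I_k) (a : int) (l1 l2 : nat)
| Goto (l : nat)
| SetVar (i : 'I_m) (f : valuation m r -> 'I_r.+1)
| IfVar (p : valuation m r -> bool) (l1 l2 : nat).

Arguments AddReg {k m r} x y z.
Arguments AddConst {k m r} x y a.
Arguments SubReg {k m r} x y z.
Arguments SubConst {k m r} x y a.
Arguments ConstSub {k m r} x a y.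
Arguments Const {k m r} x a.
Arguments Read {k m r} x.
Arguments Write {k m r} x.
Arguments IfReg {k m r} R x y l1 l2.
Arguments IfConst {k m r} R x a l1 l2.
Arguments Goto {k m r} l.
Arguments SetVar {k m r} i f.
Arguments IfVar {k m r} p l1 l2.

(* Lines are numbered from 0. *)
Definition program (k m r : nat) := seq (command k m r).

Record config (k m r : nat) := Config {
  pc : nat;
  regs : {ffun 'I_k -> int};
  vars : valuation m r;
  input : seq int;   (* the integers not yet read *)
  output : seq int   (* the integers written so far, oldest first *)
}.

Definition update (I : finType) (T : Type) (f : {ffun I -> T}) (i : I) (a : T)
  : {ffun I -> T} := [ffun j => if j == i then a else f j].

(* A command reading from an exhausted input cannot be executed. *)
Definition exec (k m r : nat) (cmd : command k m r) (c : config k m r)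
  : option (config k m r) :=
  let: Config l g v inp out := c in
  let assign x a := Some (Config l.+1 (update g x a) v inp out) in
  let jump l' := Some (Config l' g v inp out) in
  match cmd with
  | AddReg x y z => assign x (g y + g z)
  | AddConst x y a => assign x (g y + a)
  | SubReg x y z => assign x (g y - g z)
  | SubConst x y a => assign x (g y - a)
  | ConstSub x a y => assign x (a - g y)
  | Const x a => assign x a
  | Read x => if inp is a :: inp'
              then Some (Config l.+1 (update g x a) v inp' out) else None
  | Write x => Some (Config l.+1 g v inp (rcons out (g x)))
  | IfReg R x y l1 l2 => jump (if compare_int R (g x) (g y) then l1 else l2)
  | IfConst R x a l1 l2 => jump (if compare_int R (g x) a then l1 else l2)
  | Goto l' => jump l'
  | SetVar i f => Some (Config l.+1 g (update v i (f v)) inp out)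
  | IfVar p l1 l2 => jump (if p v then l1 else l2)
  end.

Definition step (k m r : nat) (P : program k m r) (c : config k m r)
  : option (config k m r) :=
  if onth P (pc c) is Some cmd then exec cmd c else None.

Definition run (k m r : nat) (P : program k m r) (t : nat) (c : config k m r)
  : option (config k m r) := iter t (obind (step P)) (Some c).

(* The machine halts when control leaves the program. *)
Definition halted (k m r : nat) (P : program k m r) (c : config k m r) : bool :=
  (size P <= pc c)%N.

(* Started on line 0 with register contents g and finite-variable values v, the
   program P on input inp halts after exactly t commands, having written out. *)
Definition halts_with (k m r : nat) (P : program k m r)
    (g : {ffun 'I_k -> int}) (v : valuation m r) (inp out : seq int) (t : nat)
  : Prop :=
  exists c : config k m r,
    [/\ run P t (Config 0 g v inp [::]) = Some c, halted P c & output c = out].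

Lemma int_size_exists (z : int) :
  exists n : nat, (1 <= n)%N && (- 2 ^+ n < z < 2 ^+ n).
Proof.
exists `|z|%N.+1; rewrite /= -ltr_norml -abszE -natrX natz ltz_nat.
exact: leq_ltn_trans (leqnSn _) (ltn_expl _ _).
Qed.

Definition int_size (z : int) : nat := ex_minn (int_size_exists z).

(* Main.v *)
Require Import Defs.
From HB Require Import structures.
From mathcomp Require Import all_boot all_order all_algebra.
From mathcomp Require Import reals exp.
From mathcomp Require Import zify ring lra.
Set Implicit Arguments.
Unset Strict Implicit.
Unset Printing Implicit Defensive.
Import Order.TTheory GRing.Theory Num.Theory.
Local Open Scope ring_scope.

(** Let [w = 2a+1] and let [u] be the least power of [2] above [w]. Doubling [w]
    and subtracting [u] whenever [w >= u] delivers the binary digits of [a] from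
    the most significant one on, and [p := 2p + digit * y] accumulates [a * y].
    The trailing [1] of [w] is an end marker: the doubled [w] equals [u] exactly
    when all digits of [a] have been delivered, so no counter is needed.
    Negative factors need no memory of signs, as [x * y = (-x) * (-y)]. *)

(** * Binary size, by powers of two and by logarithms *)

Lemma int_sizeP (z : int) :
  [/\ (1 <= int_size z)%N, - 2 ^+ int_size z < z < 2 ^+ int_size z &
      forall n, (1 <= n)%N -> - 2 ^+ n < z < 2 ^+ n -> (int_size z <= n)%N].
Proof.
rewrite /int_size; case: ex_minnP => n /andP[n1 zn] n_min; split=> // i i1 zi.
by apply: n_min; rewrite i1.
Qed.

Lemma int_size_bounds (z : int) : 1 <= z ->
  z < 2 ^+ int_size z /\ forall i, (i < int_size z)%N -> 2 ^+ i <= z.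
Proof.
move=> z1; have [_ /andP[_ zlt] zmin] := int_sizeP z; split=> // -[|i] ilt //.
rewrite leNgt; apply/negP => zi; have : (int_size z <= i.+1)%N.
  apply: zmin => //; rewrite zi andbT.
  by have := exprn_gt0 i.+1 (ltr0n int 2); lia.
by lia.
Qed.

(** For [a >= 0], the exponent of the power of two [u] of the algorithm; all running times are
    bounded in terms of it. *)
Definition digits (a : int) : nat := int_size (2 * a + 1).

Lemma digits_bounds (a : int) : 0 <= a ->
  2 * a + 1 < 2 ^+ digits a /\ forall i, (i < digits a)%N -> 2 ^+ i <= 2 * a + 1.
Proof. by move=> a_ge0; apply: int_size_bounds; lia. Qed.

Lemma digits_gt0 (a : int) : (0 < digits a)%N.
Proof. by have [] := int_sizeP (2 * a + 1). Qed.

(** The appended bit costs at most one more digit, which [int_size a >= 1] absorbs into the factor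
    2. *)
Lemma digits_le (a : int) : 0 <= a -> (digits a <= 2 * int_size a)%N.
Proof.
move=> a_ge0; have [s_gt0 /andP[_ a_lt] _] := int_sizeP a.
have [_ _ /(_ (int_size a).+1 isT)] := int_sizeP (2 * a + 1).
by rewrite -/(digits a) exprS => digits_min; apply: (leq_trans (digits_min _)); lia.
Qed.

(** Take logarithms in [a <= 2 ^+ digits a <= 4 * a + 2 <= a ^+ 4], the last inequality by
    [a >= 2]. *)
Lemma digits_ln (R : realType) (a : int) : 2 <= a ->
  ln (a%:~R : R) <= (digits a)%:R * ln 2 <= 4 * ln (a%:~R : R).
Proof.
move=> a_ge2; have a_ge0 : 0 <= a by lia.
have [a_lt a_ge] := digits_bounds a_ge0.
have ln_le (b c : int) : 0 < b -> b <= c -> ln (b%:~R : R) <= ln (c%:~R).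
  by move=> b_gt0 bc; rewrite ler_ln ?posrE ?ltr0z ?ler_int //; lia.
have lnX (b : int) n : 0 < b -> ln ((b ^+ n)%:~R : R) = n%:R * ln (b%:~R).
  by move=> b_gt0; rewrite rmorphXn /= lnXn ?ltr0z // mulr_natl.
rewrite -(lnX 2) // -(lnX a 4); last by lia.
apply/andP; split; apply: ln_le; rewrite ?exprn_gt0 //; try lia.
case: (digits a) (digits_gt0 a) a_ge => // n _ /(_ n (leqnn _)) pow_le.
have : 2 ^+ n.+1 <= 4 * a + 2 by rewrite exprS; lia.
move=> /le_trans; apply; rewrite (_ : a ^+ 4 = (a * a) * (a * a)); last by ring.
have : 2 * a <= a * a by rewrite ler_pM2r; lia.
by move: (a * a) => b ab; have : 4 * b <= b * b; [rewrite ler_pM2r|]; lia.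
Qed.

(** * Execution with two-sided time bounds *)

Section Execution.
Variables (k m r : nat) (P : program k m r).
Implicit Types (c : config k m r) (lo hi : nat) (out : seq int).

(** The start [c] is arbitrary, so that a program can be analysed from its last lines backwards;
    [lo] serves the logarithmic lower bound for squaring. *)
Definition outputs_within c lo hi out :=
  exists t c', [/\ run P t c = Some c', halted P c', output c' = out &
                   (lo <= t <= hi)%N].

Lemma outputs_halted c lo hi : halted P c -> lo = 0%N ->
  outputs_within c lo hi (output c).
Proof. by move=> cP ->; exists 0%N, c. Qed.

Lemma outputs_step c c' lo hi out : step P c = Some c' -> (0 < hi)%N ->
  outputs_within c' lo.-1 hi.-1 out -> outputs_within c lo hi out.
Proof.
move=> cc' hi_gt0 [t [c'' [run_t c''P outE /andP[lot thi]]]].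
by exists t.+1, c''; split=> //; [rewrite /run iterSr /= cc' | lia].
Qed.

Lemma outputs_weaken c lo hi lo' hi' out : (lo' <= lo)%N -> (hi <= hi')%N ->
  outputs_within c lo hi out -> outputs_within c lo' hi' out.
Proof. by move=> ? ? [t [c' [? ? ? ?]]]; exists t, c'; split=> //; lia. Qed.

End Execution.

Definition rw : 'I_4 := @Ordinal 4 0 isT.
Definition ry : 'I_4 := @Ordinal 4 1 isT.
Definition rp : 'I_4 := @Ordinal 4 2 isT.
Definition ru : 'I_4 := @Ordinal 4 3 isT.

Definition bank (w y p u : int) : {ffun 'I_4 -> int} :=
  [ffun i : 'I_4 => nth 0 [:: w; y; p; u] i].

Lemma bank_eta (g : {ffun 'I_4 -> int}) : g = bank (g rw) (g ry) (g rp) (g ru).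
Proof.
apply/ffunP => i; rewrite ffunE.
by case: i => -[|[|[|[|]]]] //= lt_i4; congr (g _); apply/val_inj.
Qed.

Lemma bankE (w y p u : int) :
  (bank w y p u rw = w) * (bank w y p u ry = y) *
  (bank w y p u rp = p) * (bank w y p u ru = u).
Proof. by rewrite !ffunE. Qed.

Lemma update_bank (w y p u a : int) :
  (update (bank w y p u) rw a = bank a y p u) *
  (update (bank w y p u) ry a = bank w a p u) *
  (update (bank w y p u) rp a = bank w y a u) *
  (update (bank w y p u) ru a = bank w y p a).
Proof.
by do !split; apply/ffunP => i; rewrite !ffunE; case: i => -[|[|[|[|]]]].
Qed.

(** * The multiplication program and its running time *)

Section Multiplier.

(* [load] puts the second factor in [ry]: it reads it or, for squaring, copies
   the first one. *)
Definition multiplier (load : command 4 0 0) : program 4 0 0 :=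
  [:: (*  0 *) Read rw;
      (*  1 *) load;
      (* make [rw] a factor of least absolute value *)
      (*  2 *) AddConst rp rw 0;
      (*  3 *) IfConst CGe rp 0 5 4;
      (*  4 *) ConstSub rp 0 rp;
      (*  5 *) AddConst ru ry 0;
      (*  6 *) IfConst CGe ru 0 8 7;
      (*  7 *) ConstSub ru 0 ru;
      (*  8 *) IfReg CLe rp ru 12 9;
      (*  9 *) AddConst rp rw 0;
      (* 10 *) AddConst rw ry 0;
      (* 11 *) AddConst ry rp 0;
      (* make [rw] nonnegative, then odd *)
      (* 12 *) IfConst CGe rw 0 15 13;
      (* 13 *) ConstSub rw 0 rw;
      (* 14 *) ConstSub ry 0 ry;
      (* 15 *) AddReg rw rw rw;
      (* 16 *) AddConst rw rw 1;
      (* find the power of two *)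
      (* 17 *) Const ru 1;
      (* 18 *) IfReg CLe ru rw 19 21;
      (* 19 *) AddReg ru ru ru;
      (* 20 *) Goto 18;
      (* deliver the digits *)
      (* 21 *) Const rp 0;
      (* 22 *) AddReg rw rw rw;
      (* 23 *) IfReg CEq rw ru 29 24;
      (* 24 *) AddReg rp rp rp;
      (* 25 *) IfReg CGe rw ru 26 22;
      (* 26 *) SubReg rw rw ru;
      (* 27 *) AddReg rp rp ry;
      (* 28 *) Goto 22;
      (* 29 *) Write rp].

Variables (load : command 4 0 0) (v : valuation 0 0).

Let at_line (l : nat) (w y p u : int) := Config l (bank w y p u) v [::] [::].
Let outputs := outputs_within (multiplier load).

Local Ltac exec_line :=
  eapply outputs_step;
    [by rewrite /step /= ?bankE ?update_bank; reflexivity | lia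
    | rewrite -/(at_line _ _ _ _ _)].

(** Loop invariant: [q] is the number formed by the [k] undelivered digits, [d] the factor gained by
    doubling [w]. Each pass doubles [d] and lowers [k], so [u] stays fixed. A pass takes at most 7
    commands, the final one 3. *)
Lemma digit_loop (y : int) (k : nat) (d q p : int) :
    0 < d -> 0 <= q < 2 ^+ k ->
  outputs (at_line 22 (d * (2 * q + 1)) y p (d * 2 ^+ k.+1)) 0 (7 * k + 3)
    [:: 2 ^+ k * p + q * y].
Proof.
elim: k d q p => [|k IHk] d q p d_gt0 q_bd.
  have -> : q = 0 by rewrite expr0 in q_bd; lia.
  do 2 exec_line; rewrite /compare_int expr1.
  have -> : d * (2 * 0 + 1) + d * (2 * 0 + 1) = d * 2 by ring.
  rewrite eqxx.
  exec_line; rewrite mul0r addr0 mul1r.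
  exact: outputs_halted.
have double : d * (2 * q + 1) + d * (2 * q + 1) = 2 * d * (2 * q + 1) by ring.
have uE : d * 2 ^+ k.+2 = 2 * d * 2 ^+ k.+1 by rewrite [in LHS]exprS; ring.
have d2_gt0 : 0 < 2 * d by lia.
have pow_gt0 := exprn_gt0 k (ltr0n int 2).
have [q_ge0 q_lt] : 0 <= q /\ q < 2 * 2 ^+ k by rewrite -exprS; lia.
do 2 exec_line; rewrite double uE /compare_int.
(* An odd number differs from an even one: the end is not reached yet. *)
have -> : (2 * d * (2 * q + 1) == 2 * d * 2 ^+ k.+1) = false.
  by rewrite (inj_eq (mulfI (lt0r_neq0 d2_gt0))) exprS; lia.
(* By parity, [2 ^+ k.+1 <= 2 * q + 1] means [2 ^+ k <= q]: the test reads the top digit of [q]. *)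
do 2 exec_line; rewrite /compare_int ler_pM2l // [in _ <= _]exprS.
case: ifP => digit; last first.
  apply: (@outputs_weaken _ _ _ _ _ 0 (7 * k + 3)); try lia.
  have -> : 2 ^+ k.+1 * p + q * y = 2 ^+ k * (p + p) + q * y.
    by rewrite exprS; ring.
  by apply: IHk; lia.
do 3 exec_line.
have -> : 2 * d * (2 * q + 1) - 2 * d * 2 ^+ k.+1
          = 2 * d * (2 * (q - 2 ^+ k) + 1) by rewrite exprS; ring.
have -> : 2 ^+ k.+1 * p + q * y
          = 2 ^+ k * (p + p + y) + (q - 2 ^+ k) * y by rewrite exprS; ring.
by apply: (@outputs_weaken _ _ _ _ _ 0 (7 * k + 3)); try lia; apply: IHk; lia.
Qed.

(** [j] doublings of [u] remain, at 3 commands each; they alone supply the lower bound. [digit_loop]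
    is then entered with [k = digits q - 1], and the 7 commands thus spared pay for the exit test,
    clearing [rp] and the final pass. *)
Lemma power_loop (y q p : int) (j i : nat) :
    0 <= q -> (i + j = digits q)%N ->
  outputs (at_line 18 (2 * q + 1) y p (2 ^+ i)) j
    (3 * j + 7 * digits q) [:: q * y].
Proof.
move=> q_ge0; have [w_lt w_ge] := digits_bounds q_ge0.
have n_gt0 := digits_gt0 q.
elim: j i => [|j IHj] i ijE.
  have {ijE} -> : i = digits q by lia.
  case: (digits q) n_gt0 w_lt {w_ge} => // k _ w_lt.
  exec_line; rewrite /compare_int leNgt w_lt; exec_line.
  apply: (@outputs_weaken _ _ _ _ _ 0 (7 * k + 3)); try lia.
  have := @digit_loop y k 1 q 0; rewrite !mul1r mulr0 add0r; apply=> //.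
  by move: w_lt; rewrite exprS; lia.
exec_line; rewrite /compare_int w_ge; last by lia.
do 2 exec_line; have -> : 2 ^+ i + 2 ^+ i = 2 ^+ i.+1 :> int by rewrite exprS; ring.
by apply: outputs_weaken (IHj i.+1 _); lia.
Qed.

Lemma multiply_nonneg (x y p u : int) : 0 <= x ->
  let n := digits x in
  outputs (at_line 15 x y p u) n (10 * n + 3) [:: x * y].
Proof.
move=> x_ge0 n; do 3 exec_line.
have -> : x + x + 1 = 2 * x + 1 by ring.
by apply: outputs_weaken (@power_loop y x p n 0%N _ _); lia.
Qed.

Lemma multiply_signed (x y p u a : int) : a = `|x| ->
  outputs (at_line 12 x y p u) (digits a) (10 * digits a + 6) [:: x * y].
Proof.
move=> aE; have a_ge0 : 0 <= a by lia.
exec_line; rewrite /compare_int; case: ifP => x_sign.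
  have -> : x = a by lia.
  by apply: outputs_weaken (multiply_nonneg y p u a_ge0); lia.
do 2 exec_line; have -> : x * y = a * (0 - y) by rewrite (_ : a = - x); [ring | lia].
have -> : 0 - x = a by lia.
by apply: outputs_weaken (multiply_nonneg _ p u a_ge0); lia.
Qed.

Lemma multiply_by_smaller (x y p u a : int) : a = Num.min `|x| `|y| ->
  outputs (at_line 2 x y p u) (digits a) (10 * digits a + 16) [:: x * y].
Proof.
move=> aE; have [b bE] : exists b, b = `|x| by exists `|x|.
have [c cE] : exists c, c = `|y| by exists `|y|.
(* The tests are treated last to first, so that both outcomes of a sign test continue with a fact
   already proved. *)
have compare : outputs (at_line 8 x y b c) (digits a) (10 * digits a + 10) [:: x * y].
  exec_line; rewrite /compare_int; case: ifP => xy.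
    by apply: outputs_weaken (@multiply_signed x y _ _ a _); lia.
  do 3 exec_line; rewrite mulrC !addr0.
  by apply: outputs_weaken (@multiply_signed y x _ _ a _); lia.
have abs_y : outputs (at_line 5 x y b u) (digits a) (10 * digits a + 13) [:: x * y].
  do 2 exec_line; rewrite addr0 /compare_int; case: ifP => y_sign.
    by rewrite {2}(_ : y = c); [apply: outputs_weaken compare |]; lia.
  exec_line; have -> : 0 - y = c by lia.
  by apply: outputs_weaken compare; lia.
do 2 exec_line; rewrite addr0 /compare_int; case: ifP => x_sign.
  by rewrite {2}(_ : x = b); [apply: outputs_weaken abs_y |]; lia.
exec_line; have -> : 0 - x = b by lia.
by apply: outputs_weaken abs_y; lia.
Qed.

End Multiplier.

Theorem theorem4 (R : realType) :
  (exists (m r : nat) (P : program 4 m r) (C : nat),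
     forall (x y : int) (g : {ffun 'I_4 -> int}) (v : valuation m r),
     exists t : nat,
       halts_with P g v [:: x; y] [:: x * y] t /\
       (t <= C * int_size (Num.min `|x| `|y|)%R)%N)
  /\
  (exists (m r : nat) (P : program 4 m r) (c1 c2 : R),
     0 < c1 /\
     forall (x : int) (g : {ffun 'I_4 -> int}) (v : valuation m r),
     exists t : nat,
       halts_with P g v [:: x] [:: x ^+ 2] t /\
       (2 <= `|x| ->
        c1 * ln (`|x|%:~R : R) <= t%:R <= c2 * ln (`|x|%:~R : R))).
Proof.
split.
  (* With [s = int_size a >= 1]: [10 * digits a + 18 <= 20 * s + 18 * s]. *)
  exists 0%N, 0%N, (multiplier (Read ry)), 38%N => x y g v.
  have [a aE] : exists a, a = Num.min `|x| `|y| by exists (Num.min `|x| `|y|).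
  have : outputs_within (multiplier (Read ry)) (Config 0 g v [:: x; y] [::])
           0 (10 * digits a + 18) [:: x * y].
    rewrite [g]bank_eta.
    do 2 (eapply outputs_step;
      [by rewrite /step /= update_bank; reflexivity | lia |]).
    apply: outputs_weaken (multiply_by_smaller (Read ry) v _ _ aE); lia.
  move=> [t [c [run_t c_halted outE /andP[_ t_le]]]]; exists t.
  split; first by exists c.
  rewrite -aE; have a_ge0 : 0 <= a by lia.
  have [s_gt0 _ _] := int_sizeP a; have := digits_le a_ge0; lia.
have ln2_gt0 : 0 < ln 2 :> R by rewrite ln_gt0 // ltr1n.
(* The time lies between [digits a] and [10 * digits a + 18 <= 28 * digits a]; [digits_ln]
   contributes another factor 4, and [112 = 28 * 4]. *)
exists 0%N, 0%N, (multiplier (AddConst ry rw 0)), (ln 2)^-1, (112 / ln 2).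
split=> [|x g v]; first by rewrite invr_gt0.
have [a aE] : exists a, a = `|x| by exists `|x|.
have : outputs_within (multiplier (AddConst ry rw 0)) (Config 0 g v [:: x] [::])
         (digits a) (10 * digits a + 18) [:: x ^+ 2].
  rewrite [g]bank_eta.
  do 2 (eapply outputs_step;
    [by rewrite /step /= ?bankE ?update_bank ?addr0; reflexivity | lia |]).
  rewrite expr2; have aE' : a = Num.min `|x| `|x| by lia.
  apply: outputs_weaken (multiply_by_smaller _ v _ _ aE'); lia.
move=> [t [c [run_t c_halted outE /andP[t_ge t_le]]]]; exists t.
split=> [|]; first by exists c.
rewrite -aE => a_ge2; have /andP[ln_ge ln_le] := digits_ln R a_ge2.
have d_gt0 := digits_gt0 a.
rewrite mulrAC ler_pdivlMr // mulrC ler_pdivrMr //; apply/andP; split.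
  by apply: (le_trans ln_ge); rewrite ler_pM2r // ler_nat.
have t_le28 : t%:R <= 28 * (digits a)%:R :> R by rewrite -natrM ler_nat; lia.
have := ler_wpM2r (ltW ln2_gt0) t_le28; lra.
Qed.
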